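(* Let $G=(V,E)$ be a finite simple connected graph and let $V_1\subseteq V$. Let $d$ be the shortest-path metric of $G$ restricted to $V_1$ (every edge has length $1$). Then \[\mathcal{P}_G\cap\mathbb{R}^{V_1}=KR(V_1,d),\] where $\mathcal{P}_G\cap\mathbb{R}^{V_1}:=\{x\in\mathcal{P}_G : x_i=0 \text{ for all } i\notin V_1\}$.
   Context: For a graph $G=(V,E)$, the symmetric edge polytope is $\mathcal{P}_G:=\mathrm{conv}\{\mathbf{e}_v-\mathbf{e}_w,\ \mathbf{e}_w-\mathbf{e}_v : \{v,w\}\in E\}\subset\mathbb{R}^V$, where $(\mathbf{e}_v)_{v\in V}$ is the standard basis. For a finite metric space $(X,d)$, the Kantorovich--Rubinstein polytope is $KR(X,d):=\mathrm{conv}\{\frac{\mathbf{e}_i-\mathbf{e}_j}{d(i,j)} : i,j\in X\}\subset\mathbb{R}^X\subseteq\mathbb{R}^V$, where for $i=j$ the point is taken to be the origin $\mathbf{0}$.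
   Formalization: The formal theorem assumes that G has at least two vertices and that V_1 is nonempty; otherwise the equality can fail, since the convex hull of the empty set is empty (e.g. G a single vertex with V_1=V, or V_1 empty and G having an edge). *)

(* Defs.v *)
From mathcomp Require Import all_boot all_order all_algebra.
From mathcomp Require Import boolp classical_sets reals convex.

Set Implicit Arguments.
Unset Strict Implicit.
Unset Printing Implicit Defensive.

Import Order.TTheory GRing.Theory Num.Theory.

Local Open Scope classical_set_scope.
Local Open Scope ring_scope.

Definition conv_hull (R : realType) (E : lmodType R) (A : set E) : set E :=
  smallest (@convex_set R E) A.

Definition basis_vec (R : realType) (V : finType) (v : V) : {ffun V -> R^o} :=
  [ffun w => (w == v)%:R].

Section Graph.
Variables (V : finType) (e : rel V).

Definition connected_graph := forall v w : V, connect e v w.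

Definition has_walk (v w : V) (n : nat) : bool :=
  [exists p : n.-tuple V, path e v p && (last v p == w)].

Lemma connect_has_walk v w : connect e v w -> exists n, has_walk v w n.
Proof.
move=> /connectP[p ep ->]; exists (size p).
by apply/existsP; exists (in_tuple p); rewrite ep eqxx.
Qed.

Definition graph_dist (e_conn : connected_graph) (v w : V) : nat :=
  ex_minn (connect_has_walk (e_conn v w)).

End Graph.

Definition sym_edge_polytope (R : realType) (V : finType) (e : rel V) :
    set {ffun V -> R^o} :=
  conv_hull [set x | exists v w : V, e v w /\
    (x = basis_vec R v - basis_vec R w \/ x = basis_vec R w - basis_vec R v)].

Arguments sym_edge_polytope R {V} e _.

(* [X : {set V}] carries the metric [d], of which only the values on [X] matter;
   R^X is viewed inside R^V. *)
Definition KR_polytope (R : realType) (V : finType) (X : {set V})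
    (d : V -> V -> R) : set {ffun V -> R^o} :=
  conv_hull [set x | exists i j : V, [/\ i \in X, j \in X &
    x = if i == j then 0 else (d i j)^-1 *: (basis_vec R i - basis_vec R j)]].

Arguments KR_polytope {R V} X d _.

(* Main.v *)
Require Import Defs.
From HB Require Import structures.
From mathcomp Require Import all_boot all_order all_algebra.
From mathcomp Require Import interval_inference.
From mathcomp Require Import boolp classical_sets reals convex.
From mathcomp Require Import ring lra.

(** A convex combination of points of [A] lying on a hyperplane [l = 0] is a
    convex combination of points of [A] on the hyperplane and of points where
    the hyperplane crosses a segment between two points of [A]. If [A] consists
    of the points [(e_i - e_j) / d(i, j)] and [l] is the [k]-th coordinate, then
    the crossings are the points [(e_i - e_j) / (d(i, k) + d(k, j))], which by
    the triangle inequality are multiples of [(e_i - e_j) / d(i, j)] by factors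
    in [0, 1]. Hence requiring the [k]-th coordinate to vanish amounts to
    deleting the point [k] from the metric space. On the other hand, the edge
    polytope is the Kantorovich-Rubinstein polytope of all the vertices, because
    [(e_i - e_j) / d(i, j)] is the average of the edge vectors along a shortest
    path from [i] to [j]. *)

Set Implicit Arguments.
Unset Strict Implicit.
Unset Printing Implicit Defensive.

Import Order.TTheory GRing.Theory Num.Theory.

Local Open Scope classical_set_scope.
Local Open Scope ring_scope.

Section Dilation.
Variables (R : numFieldType) (E : lmodType R).
Implicit Types (A B : set E) (x y : E) (a b c t : R).

Lemma convex_setP A : @convex_set R E A <->
  forall x y t, 0 <= t -> t <= 1 -> A x -> A y -> A (t *: x + (1 - t) *: y).
Proof.
split=> [cA x y t t0 t1 Ax Ay|cA x y t /set_mem Ax /set_mem Ay].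
  by have /set_mem := cA x y (Itv01 t0 t1) (mem_set Ax) (mem_set Ay).
by apply/mem_set/cA.
Qed.

Lemma convex_setWP A : @convex_set R E A <->
  forall x y t, 0 < t -> t < 1 -> A x -> A y -> A (t *: x + (1 - t) *: y).
Proof.
rewrite convex_setP; split=> cA x y t t0 t1; first by apply: cA; apply: ltW.
have [->|t_neq0] := eqVneq t 0; first by rewrite scale0r add0r subr0 scale1r.
have [->|t_neq1] := eqVneq t 1; first by rewrite subrr scale0r addr0 scale1r.
by apply: cA; rewrite ?lt0r ?lt_neqAle ?t_neq0 ?t_neq1.
Qed.

(* The dilate by [0] is [[set 0]] even when [A] is empty. *)
Definition dilate c A : set E :=
  [set x | if c == 0 then x = 0 else A (c^-1 *: x)].

Lemma dilate0 A : dilate 0 A = [set 0].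
Proof. by rewrite /dilate eqxx. Qed.

Lemma dilate1 A : dilate 1 A = A.
Proof. by rewrite /dilate oner_eq0 invr1; under eq_fun do rewrite scale1r. Qed.

Lemma dilate_neq0 A c x : c != 0 -> dilate c A x -> A (c^-1 *: x).
Proof. by rewrite /dilate /= => /negPf ->. Qed.

Lemma dilateS A B c : A `<=` B -> dilate c A `<=` dilate c B.
Proof. by move=> AB x; rewrite /dilate /=; case: eqP => // _ /AB. Qed.

Lemma dilateZ A a c x : dilate c A x -> dilate (a * c) A (a *: x).
Proof.
have [->|a0] := eqVneq a 0; first by rewrite mul0r scale0r dilate0.
rewrite /dilate /= mulf_eq0 (negPf a0) /=.
case: eqVneq => [_ ->|c0]; first by rewrite scaler0.
by rewrite scalerA invfM mulrAC mulVf // mul1r.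
Qed.

Lemma dilateD A a b x y : @convex_set R E A -> 0 <= a -> 0 <= b ->
  dilate a A x -> dilate b A y -> dilate (a + b) A (x + y).
Proof.
move=> /convex_setP cA a0 b0.
have [->|a_neq0] := eqVneq a 0; first by rewrite dilate0 => ->; rewrite !add0r.
have [->|b_neq0] := eqVneq b 0.
  by rewrite dilate0 => Ax ->; rewrite !addr0.
move=> /(dilate_neq0 a_neq0) Ax /(dilate_neq0 b_neq0) Ay.
have ab_gt0 : 0 < a + b by rewrite addr_gt0 // lt0r ?a_neq0 ?b_neq0.
rewrite /dilate /= gt_eqF //.
have := cA _ _ (a / (a + b)) (divr_ge0 a0 (ltW ab_gt0)) _ Ax Ay.
rewrite ler_pdivrMr // mul1r lerDl b0 => /(_ isT).
rewrite (_ : 1 - a / (a + b) = b / (a + b)); last first.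
  by field; rewrite gt_eqF.
by rewrite !scalerA mulrAC divff // mulrAC divff // mul1r -scalerDr.
Qed.

Lemma convex_set_scale A x t : @convex_set R E A -> A 0 -> A x ->
  0 <= t -> t <= 1 -> A (t *: x).
Proof.
move=> /convex_setP cA A0 Ax t0 t1.
by have := cA x 0 t t0 t1 Ax A0; rewrite scaler0 addr0.
Qed.

Lemma scalar_conv (l : {scalar E}) x y t :
  l (t *: x + (1 - t) *: y) = t * l x + (1 - t) * l y.
Proof. by rewrite linearD !linearZ. Qed.

Lemma convex_set_hyperplane (l : {scalar E}) :
  @convex_set R E [set x | l x = 0].
Proof.
apply/convex_setP => x y t _ _ /= lx ly.
by rewrite scalar_conv lx ly !mulr0 addr0.
Qed.

Lemma convex_set_dilate (w : E -> R) (v : E -> E) A : @convex_set R E A ->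
  (forall x y t, w (t *: x + (1 - t) *: y) = t * w x + (1 - t) * w y) ->
  (forall x y t, v (t *: x + (1 - t) *: y) = t *: v x + (1 - t) *: v y) ->
  @convex_set R E [set x | 0 <= w x /\ dilate (w x) A (v x)].
Proof.
move=> cA w_affine v_affine; apply/convex_setP => x y t t0 t1 [wx Ax] [wy Ay].
have t'0 : 0 <= 1 - t by rewrite subr_ge0.
rewrite /= w_affine v_affine; split; first by rewrite addr_ge0 ?mulr_ge0.
by apply: dilateD; rewrite ?mulr_ge0 //; apply: dilateZ.
Qed.

Definition convex_join A B : set E :=
  [set x | exists a b u v, [/\ 0 <= a, 0 <= b, a + b = 1 &
    [/\ dilate a A u, dilate b B v & x = u + v]]].

Lemma convex_join_convex A B : @convex_set R E A -> @convex_set R E B ->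
  @convex_set R E (convex_join A B).
Proof.
move=> cA cB; apply/convex_setP => x y t t0 t1.
move=> [a [b [u [v [a0 b0 ab [Au Bv ->]]]]]].
move=> [a' [b' [u' [v' [a'0 b'0 ab' [Au' Bv' ->]]]]]].
have t'0 : 0 <= 1 - t by rewrite subr_ge0.
exists (t * a + (1 - t) * a'), (t * b + (1 - t) * b').
exists (t *: u + (1 - t) *: u'), (t *: v + (1 - t) *: v').
split; rewrite ?addr_ge0 ?mulr_ge0 //.
  by rewrite addrACA -!mulrDr ab ab' !mulr1 addrC subrK.
split; last by rewrite !scalerDr addrACA.
- by apply: dilateD; rewrite ?mulr_ge0 //; apply: dilateZ.
- by apply: dilateD; rewrite ?mulr_ge0 //; apply: dilateZ.
Qed.

End Dilation.

Section ConvexHull.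
Variables (R : realType) (E : lmodType R).
Implicit Types (A B C : set E) (x y p n : E) (l : {scalar E}).

Lemma conv_hull_convex A : @convex_set R E (conv_hull A).
Proof.
apply/convex_setP => x y t t0 t1 Ax Ay M [cM AM].
by move/convex_setP: (cM); apply => //; [apply: Ax|apply: Ay].
Qed.

Lemma conv_hullS A B : A `<=` B -> conv_hull A `<=` conv_hull B.
Proof. by apply: sub_smallest2r; apply: conv_hull_convex. Qed.

Lemma conv_hullU A B :
  conv_hull (A `|` B) `<=` convex_join (conv_hull A) (conv_hull B).
Proof.
apply: smallest_sub => [|x [Ax|Bx]].
- by apply: convex_join_convex; apply: conv_hull_convex.
- exists 1, 0, x, 0; rewrite ler01 !addr0 dilate1 dilate0.
  by split=> //; split=> //; apply: sub_gen_smallest.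
- exists 0, 1, 0, x; rewrite ler01 !add0r dilate1 dilate0.
  by split=> //; split=> //; apply: sub_gen_smallest.
Qed.

Lemma conv_hull_supporting_hyperplane A l : (forall x, A x -> 0 <= l x) ->
  conv_hull A `&` [set x | l x = 0] `<=`
  conv_hull (A `&` [set x | l x = 0]).
Proof.
move=> l_ge0 x [Ax lx0]; pose F := conv_hull (A `&` [set x | l x = 0]).
suff [_ /(_ lx0)//] : 0 <= l x /\ (l x = 0 -> F x).
move: x Ax {lx0}; apply: smallest_sub => [|x Ax]; last first.
  by split=> [|lx0]; [exact: l_ge0|exact: sub_gen_smallest].
apply/convex_setWP => x y t t_gt0 t_lt1 [lx Fx] [ly Fy].
have t'_gt0 : 0 < 1 - t by rewrite subr_gt0.
rewrite /= scalar_conv; split; first by rewrite addr_ge0 // mulr_ge0 // ltW.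
move=> lxy0; have /convex_setWP cF : @convex_set R E F.
  exact: conv_hull_convex.
by apply: cF => //; [apply: Fx|apply: Fy]; nra.
Qed.

Lemma conv_hull_lt0 A l : (forall x, A x -> l x < 0) ->
  forall x, conv_hull A x -> l x < 0.
Proof.
move=> A_lt0; apply: smallest_sub => //.
apply/convex_setP => x y t t0 t1 /= lx ly.
rewrite scalar_conv; nra.
Qed.

(* The dilation factor and the vector are both affine in [p] and in [n]. *)
Lemma dilate_crossing_conv_hull A B C l : @convex_set R E C ->
  (forall p n, A p -> B n ->
    0 <= l p - l n /\ dilate (l p - l n) C (l p *: n - l n *: p)) ->
  forall p n, conv_hull A p -> conv_hull B n ->
    0 <= l p - l n /\ dilate (l p - l n) C (l p *: n - l n *: p).
Proof.
move=> cC AB p n Ap Bn; move: p Ap.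
apply: smallest_sub => [|p Ap]; first apply: convex_set_dilate => //.
- by move=> x y t; rewrite scalar_conv; ring.
- move=> x y t; rewrite scalar_conv; move: (1 - t) => s.
  rewrite scalerDl [l n *: _]scalerDr opprD addrACA !scalerBr !scalerA.
  by rewrite ![l n * _]mulrC.
move: n Bn; apply: smallest_sub => [|n Bn]; last exact: AB.
apply: convex_set_dilate => // x y t; rewrite scalar_conv; first by ring.
move: (1 - t) => s.
rewrite scalerDl [l p *: _]scalerDr opprD addrACA !scalerBr !scalerA.
by rewrite ![l p * _]mulrC.
Qed.

Lemma dilate_crossing A B C l a b u v : @convex_set R E C ->
  (forall p n, A p -> B n -> dilate (l p - l n) C (l p *: n - l n *: p)) ->
  dilate a A u -> dilate b B v ->
  dilate (b * l u - a * l v) C (l u *: v - l v *: u).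
Proof.
move=> cC AB.
have [->|a0] := eqVneq a 0.
  rewrite dilate0 => -> _; rewrite linear0 mulr0 mul0r subrr.
  by rewrite scale0r scaler0 subrr dilate0.
have [->|b0] := eqVneq b 0.
  rewrite dilate0 => _ ->; rewrite linear0 mulr0 mul0r subrr.
  by rewrite scale0r scaler0 subrr dilate0.
move=> /(dilate_neq0 a0) Au /(dilate_neq0 b0) Bv.
have /(dilateZ (a * b)) := AB _ _ Au Bv.
rewrite ![l (_ *: _)]linearZ /= scalerBr !scalerA.
by congr (dilate _ C (_ *: _ - _ *: _)); field; rewrite a0 b0.
Qed.

(* The point where the line through [p] and [n] meets the hyperplane [l = 0],
   provided that [l p != l n]. *)
Definition crossing l p n : E := (l p - l n)^-1 *: (l p *: n - l n *: p).

Definition section_generators l A : set E :=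
  (A `&` [set x | l x = 0]) `|`
  [set x | exists p n, [/\ A p, A n, 0 < l p, l n < 0 & x = crossing l p n]].

Lemma dilate_section_generators A l p n :
  A p -> A n -> 0 <= l p -> l n < 0 ->
  dilate (l p - l n) (section_generators l A) (l p *: n - l n *: p).
Proof.
move=> Ap An lp_ge0 ln_lt0.
rewrite /dilate /= subr_eq0 gt_eqF ?(lt_le_trans ln_lt0) //.
have [lp0|lp_neq0] := eqVneq (l p) 0; [left|right].
  rewrite lp0 scale0r !sub0r -scaleNr scalerA mulVf ?scale1r //.
  by rewrite oppr_eq0 lt_eqF.
by exists p, n; split=> //; rewrite lt0r lp_neq0.
Qed.

Lemma conv_hull_halfspaces A l :
  conv_hull A `<=` convex_join (conv_hull (A `&` [set p | 0 <= l p]))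
                               (conv_hull (A `&` [set n | l n < 0])).
Proof.
apply: subset_trans (@conv_hullU _ _); apply: conv_hullS => x Ax.
by have [lx|lx] := leP 0 (l x); [left|right].
Qed.

Lemma conv_hull_hyperplane A l :
  conv_hull A `&` [set x | l x = 0] `<=` conv_hull (section_generators l A).
Proof.
move=> x [/(@conv_hull_halfspaces _ l)[a [b [u [v [a0 b0 ab1 []]]]]]].
set P := A `&` _; set N := A `&` _ => Pu Nv xuv /= lx0.
have cC : @convex_set R E (conv_hull (section_generators l A)).
  exact: conv_hull_convex.
have PN_crossing p n : conv_hull P p -> conv_hull N n ->
    dilate (l p - l n) (conv_hull (section_generators l A))
      (l p *: n - l n *: p).
  move=> Pp Nn; apply: (dilate_crossing_conv_hull cC _ Pp Nn).2.
  move=> {Pp Nn} {}p {}n [Ap lp] [An ln].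
  rewrite subr_ge0 (le_trans (ltW ln)) //; split=> //.
  exact/(dilateS (@sub_gen_smallest _ _ _))/dilate_section_generators.
have lvE : l v = - l u.
  by apply/eqP; rewrite -addr_eq0 addrC -linearD -xuv lx0.
have [lu0|lu_neq0] := eqVneq (l u) 0; last first.
  (* As [l v = - l u], the combination [l u *: v - l v *: u] is [l u *: x]. *)
  have := dilate_crossing cC PN_crossing Pu Nv.
  rewrite lvE mulrN scaleNr !opprK -scalerDr addrC [v + u]addrC -xuv.
  rewrite -mulrDl ab1 mul1r => /(dilate_neq0 lu_neq0).
  by rewrite scalerA mulVf // scale1r.
have b_eq0 : b = 0.
  apply: contra_eq lu0 => b_neq0; rewrite -oppr_eq0 -lvE.
  have N_lt0 y : N y -> l y < 0 by case.
  have := conv_hull_lt0 N_lt0 (dilate_neq0 b_neq0 Nv).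
  by rewrite linearZ /=; apply: contraTneq => ->; rewrite mulr0 ltxx.
move: ab1 Pu Nv; rewrite b_eq0 dilate0 addr0 => ->.
rewrite dilate1 => Pu v0; rewrite v0 addr0 in xuv; rewrite -{}xuv in Pu.
have P_ge0 y : P y -> 0 <= l y by case.
apply: conv_hullS (conv_hull_supporting_hyperplane P_ge0 (conj Pu lx0)).
by move=> y [[Ay _] ly0]; left.
Qed.

End ConvexHull.

Section KantorovichRubinstein.
Variables (R : realType) (V : finType) (d : V -> V -> R).
Implicit Types (X Y : {set V}) (x : {ffun V -> R^o}) (i j k : V).

Definition coordinate k x : R := x k.

Lemma coordinate_is_linear k : scalar (coordinate k).
Proof. by move=> a x y; rewrite /coordinate !ffunE. Qed.

HB.instance Definition _ k := GRing.isLinear.Build R {ffun V -> R^o} R _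
  (coordinate k) (coordinate_is_linear k).

Definition molecule i j : {ffun V -> R^o} :=
  (d i j)^-1 *: (basis_vec R i - basis_vec R j).

Lemma molecule_diag i : molecule i i = 0.
Proof. by rewrite /molecule subrr scaler0. Qed.

Lemma coordinate_molecule i j k :
  coordinate k (molecule i j) = (d i j)^-1 * ((i == k)%:R - (j == k)%:R).
Proof. by rewrite linearZ /= /coordinate !ffunE ![k == _]eq_sym. Qed.

Definition molecules X : set {ffun V -> R^o} :=
  [set x | exists i j, [/\ i \in X, j \in X & x = molecule i j]].

Lemma KR_polytopeE X : KR_polytope X d = conv_hull (molecules X).
Proof.
have moleculeE i j : molecule i j =
    if i == j then 0 else (d i j)^-1 *: (basis_vec R i - basis_vec R j).
  by have [->|] := eqVneq i j; rewrite ?molecule_diag.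
congr conv_hull; apply/seteqP; split=> _ [i [j [iX jX ->]]];
  by exists i, j; rewrite moleculeE.
Qed.

Lemma KR_polytope_molecule X i j : i \in X -> j \in X ->
  KR_polytope X d (molecule i j).
Proof.
by move=> iX jX; rewrite KR_polytopeE; apply: sub_gen_smallest; exists i, j.
Qed.

Lemma KR_polytopeS X Y : X \subset Y ->
  KR_polytope X d `<=` KR_polytope Y d.
Proof.
move=> /fintype.subsetP XY; apply: conv_hullS => x [i [j [iX jX ->]]].
by exists i, j; rewrite !XY.
Qed.

Lemma KR_polytope_supp X x k : KR_polytope X d x -> k \notin X -> x k = 0.
Proof.
rewrite KR_polytopeE => + kX; move: x; apply: smallest_sub.
  exact: (@convex_set_hyperplane _ _ (coordinate k)).
move=> _ [i [j [iX jX ->]]] /=; rewrite -/(coordinate k _) coordinate_molecule.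
have neq_k l : l \in X -> (l == k) = false.
  by move=> lX; apply: contraNF kX => /eqP <-.
by rewrite !neq_k // subrr mulr0.
Qed.

Hypothesis d_gt0 : forall i j, i != j -> 0 < d i j.
Hypothesis d_triangle : forall i j k, d i k <= d i j + d j k.

Lemma coordinate_molecule_gt0 i j k : 0 < coordinate k (molecule i j) ->
  i = k /\ j != k.
Proof.
rewrite coordinate_molecule; have [->|ij] := eqVneq i j.
  by rewrite subrr mulr0 ltxx.
rewrite pmulr_rgt0 ?invr_gt0 ?d_gt0 // subr_gt0 ltr_nat.
by case: (eqVneq i k); case: (eqVneq j k).
Qed.

Lemma coordinate_molecule_lt0 i j k : coordinate k (molecule i j) < 0 ->
  i != k /\ j = k.
Proof.
rewrite coordinate_molecule; have [->|ij] := eqVneq i j.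
  by rewrite subrr mulr0 ltxx.
rewrite pmulr_rlt0 ?invr_gt0 ?d_gt0 // subr_lt0 ltr_nat.
by case: (eqVneq i k); case: (eqVneq j k).
Qed.

Lemma coordinate_molecule_eq0 i j k : i != j ->
  coordinate k (molecule i j) = 0 -> i != k /\ j != k.
Proof.
move=> ij; rewrite coordinate_molecule => /eqP.
rewrite mulf_eq0 invr_eq0 gt_eqF ?d_gt0 //= subr_eq0 eqr_nat.
by case: (eqVneq i k) ij => [->|_]; case: (eqVneq j k).
Qed.

Lemma crossing_molecule i j k : i != k -> j != k ->
  crossing (coordinate k) (molecule k j) (molecule i k) =
  (d i k + d k j)^-1 *: (basis_vec R i - basis_vec R j).
Proof.
move=> ik jk.
rewrite /crossing /= !coordinate_molecule eqxx (negPf ik) (negPf jk) subr0.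
rewrite sub0r mulr1 mulrN1 !scaleNr !opprK /molecule !scalerA.
rewrite [(d i k)^-1 * _]mulrC -scalerDr addrA subrK scalerA; congr (_ *: _).
have dik := d_gt0 ik; have dkj : 0 < d k j by rewrite d_gt0 // eq_sym.
by field; rewrite !gt_eqF // addr_gt0.
Qed.

Lemma KR_polytope_detour X i j k : i \in X -> j \in X -> i != k -> j != k ->
  KR_polytope X d
    ((d i k + d k j)^-1 *: (basis_vec R i - basis_vec R j)).
Proof.
move=> iX jX ik jk; have [->|ij] := eqVneq i j.
  by rewrite subrr scaler0 -(molecule_diag j); apply: KR_polytope_molecule.
have dij := d_gt0 ij.
have dikj : 0 < d i k + d k j by rewrite addr_gt0 ?d_gt0 // eq_sym.
have -> : (d i k + d k j)^-1 = d i j / (d i k + d k j) / d i j.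
  by field; rewrite !gt_eqF.
rewrite -scalerA; apply: convex_set_scale => //.
- exact: conv_hull_convex.
- by rewrite -(molecule_diag j); apply: KR_polytope_molecule.
- exact: KR_polytope_molecule.
- by rewrite divr_ge0 // ltW.
- by rewrite ler_pdivrMr // mul1r.
Qed.

Lemma KR_polytope_delete X x k : (0 < #|X :\ k|)%N ->
  KR_polytope X d x -> x k = 0 -> KR_polytope (X :\ k) d x.
Proof.
move=> /card_gt0P[j0 j0X]; rewrite KR_polytopeE => Xx xk0.
have := @conv_hull_hyperplane R _ _ (coordinate k) x (conj Xx xk0).
move: x {Xx xk0}; apply: smallest_sub; first exact: conv_hull_convex.
move=> y [[[i [j [iX jX ->]]] /=]|[p [n [[i [j [_ jX ->]]]]]]].
  have [-> _|ij /(coordinate_molecule_eq0 ij)[ik jk]] := eqVneq i j.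
    by rewrite molecule_diag -(molecule_diag j0); apply: KR_polytope_molecule.
  by apply: KR_polytope_molecule; rewrite !inE ?ik ?jk.
move=> [i' [j' [i'X _ ->]]] /coordinate_molecule_gt0[-> jk].
move=> /coordinate_molecule_lt0[ik ->] ->; rewrite crossing_molecule //.
by apply: KR_polytope_detour; rewrite // !inE ?ik ?jk.
Qed.

Lemma KR_polytope_restrict X Y : (0 < #|Y|)%N -> Y \subset X ->
  [set x | KR_polytope X d x /\ forall i, i \notin Y -> x i = 0] =
  KR_polytope Y d.
Proof.
move=> Y_gt0 YX; apply/seteqP; split=> [x [Xx xY]|x Yx]; last first.
  by split=> [|i]; [exact: KR_polytopeS Yx|exact: KR_polytope_supp].
have [m] := ubnP #|X :\: Y|; elim: m X YX Xx => // m IH X YX Xx.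
have [XY0 _|[k]] := set_0Vmem (X :\: Y).
  by apply: KR_polytopeS Xx; rewrite -finset.setD_eq0 XY0.
rewrite inE => /andP[kY kX]; rewrite ltnS => card_le.
have YXk : Y \subset X :\ k by rewrite subsetD1 YX.
apply: (IH (X :\ k)) => //.
  apply: KR_polytope_delete (xY k kY) => //.
  exact: leq_trans Y_gt0 (subset_leq_card YXk).
rewrite finset.setDDl finset.setUC -finset.setDDl (leq_trans _ card_le) //.
by rewrite [ltnRHS](cardsD1 k) inE kY kX.
Qed.

End KantorovichRubinstein.

Section GraphDistance.
Variables (V : finType) (e : rel V) (e_conn : connected_graph e).

Lemma graph_dist_path v w :
  exists p, [/\ path e v p, last v p = w & size p = graph_dist e_conn v w].
Proof.
rewrite /graph_dist; case: ex_minnP => n /existsP[p /andP[ep /eqP lp]] _.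
by exists p; rewrite size_tuple.
Qed.

Lemma graph_dist_le v p : path e v p ->
  (graph_dist e_conn v (last v p) <= size p)%N.
Proof.
move=> ep; rewrite /graph_dist; case: ex_minnP => n _; apply.
by apply/existsP; exists (in_tuple p); rewrite ep eqxx.
Qed.

Lemma graph_dist_gt0 v w : v != w -> (0 < graph_dist e_conn v w)%N.
Proof.
by have [[|x p] [_ /= <- <-]] := graph_dist_path v w; rewrite ?eqxx.
Qed.

Lemma graph_dist_triangle u v w :
  (graph_dist e_conn u w <= graph_dist e_conn u v + graph_dist e_conn v w)%N.
Proof.
have [p [ep lp <-]] := graph_dist_path u v.
have [q [eq lq <-]] := graph_dist_path v w.
have := @graph_dist_le u (p ++ q).
by rewrite cat_path last_cat size_cat lp ep eq lq => /(_ isT).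
Qed.

Lemma graph_dist_edge v w : irreflexive e -> e v w ->
  graph_dist e_conn v w = 1%N.
Proof.
move=> e_irr evw; apply/eqP; rewrite eqn_leq.
have := @graph_dist_le v [:: w]; rewrite /= evw => -> //=.
by apply: graph_dist_gt0; apply: contraTneq evw => ->; rewrite e_irr.
Qed.

Lemma connected_graph_edge : (1 < #|V|)%N -> exists v w, e v w.
Proof.
move=> /card_gt1P[v [w [_ _ vw]]].
have [[|x p] [/= ep lp _]] := graph_dist_path v w.
  by rewrite lp eqxx in vw.
by exists v, x; case/andP: ep.
Qed.

End GraphDistance.

Section SymmetricEdgePolytope.
Variables (R : realType) (V : finType) (e : rel V).
Hypothesis e_conn : connected_graph e.

Let d i j : R := (graph_dist e_conn i j)%:R.

Lemma sym_edge_polytope_path v p : path e v p ->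
  dilate (size p)%:R (sym_edge_polytope R e)
    (basis_vec R v - basis_vec R (last v p)).
Proof.
elim: p v => [v _|w p IH v /= /andP[evw ep]]; first by rewrite dilate0 subrr.
rewrite -nat1r -[X in X - _](subrK (basis_vec R w)) -addrA.
apply: dilateD (IH w ep) => //; first exact: conv_hull_convex.
by rewrite dilate1; apply: sub_gen_smallest; exists v, w; split; [|left].
Qed.

Lemma sym_edge_polytope_molecule i j : symmetric e -> (1 < #|V|)%N ->
  sym_edge_polytope R e (molecule d i j).
Proof.
move=> e_sym V_gt1; have [->|ij] := eqVneq i j; last first.
  have [p [ep lp sp]] := graph_dist_path e_conn i j.
  have := sym_edge_polytope_path ep; rewrite lp sp; apply: dilate_neq0.
  by rewrite pnatr_eq0 -lt0n graph_dist_gt0.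
have [v [w evw]] := connected_graph_edge e_conn V_gt1.
have := @sym_edge_polytope_path v [:: w; v].
rewrite /= evw e_sym evw subrr => /(_ isT)/(dilate_neq0 _).
by rewrite scaler0 molecule_diag; apply; rewrite pnatr_eq0.
Qed.

Lemma sym_edge_polytope_KR : symmetric e -> irreflexive e -> (1 < #|V|)%N ->
  sym_edge_polytope R e = KR_polytope [set: V]%SET d.
Proof.
move=> e_sym e_irr V_gt1; rewrite KR_polytopeE; apply/seteqP.
split; apply: smallest_sub; try exact: conv_hull_convex; last first.
  by move=> _ [i [j [_ _ ->]]]; apply: sym_edge_polytope_molecule.
have edge_molecule a b : e a b ->
    molecules d [set: V]%SET (basis_vec R a - basis_vec R b).
  move=> eab; exists a, b; rewrite !finset.in_setT; split=> //.
  by rewrite /molecule /d graph_dist_edge // invr1 scale1r.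
move=> _ [a [b [eab [|] ->]]]; apply: sub_gen_smallest.
  exact: edge_molecule.
by apply: edge_molecule; rewrite e_sym.
Qed.

End SymmetricEdgePolytope.

Unset Implicit Arguments.

Theorem theorem2p5 (R : realType) (V : finType) (e : rel V)
    (e_sym : symmetric e) (e_irr : irreflexive e)
    (e_conn : connected_graph e) (V_gt1 : (1 < #|V|)%N)
    (V1 : {set V}) (V1_gt0 : (0 < #|V1|)%N) :
  [set x | sym_edge_polytope R e x /\ forall i : V, i \notin V1 -> x i = 0] =
  KR_polytope V1 (fun i j => (graph_dist e_conn i j)%:R : R).
Proof.
rewrite (sym_edge_polytope_KR R e_conn e_sym e_irr V_gt1).
apply: KR_polytope_restrict => //.
- by move=> i j ij; rewrite ltr0n graph_dist_gt0.
- by move=> i j k; rewrite -natrD ler_nat graph_dist_triangle.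
Qed.
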